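(* Let $\gamma$ be a convex piecewise affine function with $\gamma(0)=0$ on a star $\omega\subset\mathbb{R}^d$ centered at the origin. Let $0\le n<d$, let $T$ be an $n$-dimensional simplex of $\omega$ such that $0\in T$, and let $\mathscr{S}$ be the set of $(n+1)$-dimensional simplices $S$ of $\omega$ such that $S\supset T$. The dual set $T^*$ of $T$ is the convex polytope given by $$T^*=\{w\in\mathbb{R}^d:\ \langle w,z\rangle=\gamma(z)\ \ \forall z\in T\quad\text{and}\quad\langle w,z\rangle\le\gamma(z)\ \ \forall z\in\omega(T)\}.$$ Moreover, the boundary $\partial T^*$ of $T^*$ is given by $\partial T^*=\bigcup\{S^*:S\in\mathscr{S}\}$.
   Context: A star $\omega$ centered at the origin is a finite union of $d$-simplices ($d\ge2$) forming a conforming simplicial partition of $\omega$, each having $0$ as a vertex, with $0$ in the interior of $\omega$; ''simplices of $\omega$'' are the simplices of this partition and their lower-dimensional faces; those containing $0$ have $0$ as a vertex. Piecewise affine means continuous and affine on each $d$-simplex; convex means being the restriction to $\omega$ of a convex function. Sub-differential at $0$: $\nabla\gamma(0)=\{w\in\mathbb{R}^d:\langle w,x\rangle\le\gamma(x)\ \forall x\in\omega\}$. For an $n$-dimensional simplex $T\ni0$ ($0\le n\le d$), $\omega(T)$ is the union of the $d$-simplices $K\subset\omega$ of the partition with $T\subset K$, and the dual set of $T$ with respect to $\gamma$ is $T^*=\{w\in\nabla\gamma(0):\langle w,z\rangle=\gamma(z)\ \forall z\in T\}$. The set $T^*$ lies in the $(d-n)$-dimensional affine plane $P=\{w:\langle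 w,z\rangle=\gamma(z)\ \forall z\in T\}$, and $\partial T^*$ denotes its boundary relative to $P$. *)

(* Defs.v *)
From mathcomp Require Import all_boot all_order all_algebra finmap.
From mathcomp Require Import all_classical all_reals all_analysis.

Set Implicit Arguments.
Unset Strict Implicit.
Unset Printing Implicit Defensive.

Import Order.TTheory GRing.Theory Num.Theory.
Import numFieldNormedType.Exports.

Local Open Scope classical_set_scope.
Local Open Scope ring_scope.

(* The library norm on 'rV[R]_d is the sup norm, which induces the Euclidean
   topology. *)
Definition dotp (R : realType) (d : nat) (u v : 'rV[R]_d) : R :=
  \sum_(i < d) u 0 i * v 0 i.

Definition chull (R : realType) (d : nat) (V : {fset 'rV[R]_d}) :
    set 'rV[R]_d :=
  [set x | exists c : 'rV[R]_d -> R,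
    [/\ forall v, v \in V -> 0 <= c v,
        \sum_(v <- V) c v = 1 & x = \sum_(v <- V) c v *: v]].

Definition aff_independent (R : realType) (d : nat) (V : {fset 'rV[R]_d}) :=
  forall c : 'rV[R]_d -> R,
    \sum_(v <- V) c v = 0 -> \sum_(v <- V) c v *: v = 0 ->
    forall v, v \in V -> c v = 0.

Definition polytope (R : realType) (d : nat) (A : set 'rV[R]_d) :=
  exists V : {fset 'rV[R]_d}, A = chull V.

(* A simplex is encoded by its finite set V of vertices, its realization being
   chull V, and its faces by the nonempty subsets of V; its dimension is
   #|` V| - 1.  A triangulation K is the finite set of its d-simplices. *)
Definition support (R : realType) (d : nat) (K : {fset {fset 'rV[R]_d}}) :
    set 'rV[R]_d :=
  \bigcup_(V in [set V | V \in K]) chull V.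

(* In [star_conforming] the intersection is never empty, since it contains 0;
   as distinct members of K have distinct vertex sets of equal size, it also
   forces distinct d-simplices to have disjoint interiors. *)
Record star (R : realType) (d : nat) (K : {fset {fset 'rV[R]_d}}) : Prop := {
  star_simplex : forall V, V \in K -> aff_independent V /\ #|` V| = d.+1 ;
  star_conforming : forall V W, V \in K -> W \in K ->
    exists F, [/\ (F `<=` V)%fset, (F `<=` W)%fset &
                  chull V `&` chull W = chull F] ;
  star_vertex : forall V, V \in K -> 0 \in V ;
  star_interior : interior (support K) 0
}.

Definition simplex_of (R : realType) (d : nat) (K : {fset {fset 'rV[R]_d}})
    (n : nat) (T : {fset 'rV[R]_d}) :=
  #|` T| = n.+1 /\ exists2 V, V \in K & (T `<=` V)%fset.

(* A function on the star is represented by a total function gamma, of which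
   only the restriction to [support K] is ever used. *)
Definition piecewise_affine (R : realType) (d : nat)
    (K : {fset {fset 'rV[R]_d}}) (gamma : 'rV[R]_d -> R) :=
  {within support K, continuous gamma} /\
  forall V, V \in K -> exists (a : 'rV[R]_d) (b : R),
    forall x, chull V x -> gamma x = dotp a x + b.

Definition convex_on_star (R : realType) (d : nat)
    (K : {fset {fset 'rV[R]_d}}) (gamma : 'rV[R]_d -> R) :=
  exists2 g : 'rV[R]_d -> R,
    convex_function [set: 'rV[R]_d] g &
    forall x, support K x -> gamma x = g x.

Definition subdiff0 (R : realType) (d : nat) (K : {fset {fset 'rV[R]_d}})
    (gamma : 'rV[R]_d -> R) : set 'rV[R]_d :=
  [set w | forall x, support K x -> dotp w x <= gamma x].

Definition local_star (R : realType) (d : nat) (K : {fset {fset 'rV[R]_d}})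
    (T : {fset 'rV[R]_d}) : set 'rV[R]_d :=
  \bigcup_(V in [set V | V \in K /\ chull T `<=` chull V]) chull V.

Definition dual_plane (R : realType) (d : nat)
    (gamma : 'rV[R]_d -> R) (T : {fset 'rV[R]_d}) : set 'rV[R]_d :=
  [set w | forall z, chull T z -> dotp w z = gamma z].

Definition dual_set (R : realType) (d : nat) (K : {fset {fset 'rV[R]_d}})
    (gamma : 'rV[R]_d -> R) (T : {fset 'rV[R]_d}) : set 'rV[R]_d :=
  [set w | subdiff0 K gamma w /\ forall z, chull T z -> dotp w z = gamma z].

(* In the topology of [subspace P] the points outside P are isolated, so for
   A contained in P this is the boundary of A relative to P. *)
Definition rel_boundary (R : realType) (d : nat) (P A : set 'rV[R]_d) :
    set 'rV[R]_d :=
  closure (A : set (subspace P)) `\` interior (A : set (subspace P)).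

(* Main.v *)
(* Two facts carry the proof.  First, a relative interior point z of T close
   to 0 has a neighbourhood covered by the d-simplices containing T, so that
   an inequality <w, .> <= gamma on omega(T), with equality at z, propagates to
   the whole star along segments issued from z, by convexity; applied to a
   d-simplex this says that each affine piece of gamma is a subgradient at 0.
   Second, a point w outside the convex hull of the gradients of gamma on the
   d-simplices containing T is separated from it by some direction u, and
   moving from z along u violates <w, .> <= gamma; hence T^* is that hull.
   For the boundary, w in T^* is interior relative to its plane as soon as
   <w, v> < gamma(v) for the finitely many vertices v outside T of the
   d-simplices containing T, and an equality at such a v means w in S^* with
   S = T + v; conversely w in S^* leaves T^* when pushed along a direction
   orthogonal to T but not to v. *)
Require Import Defs.
From mathcomp Require Import all_boot all_order all_algebra finmap.
From mathcomp Require Import all_classical all_reals all_analysis.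
From mathcomp Require Import ring lra.

Set Implicit Arguments.
Unset Strict Implicit.
Unset Printing Implicit Defensive.

Import Order.TTheory GRing.Theory Num.Theory.
Import numFieldNormedType.Exports.

Local Open Scope classical_set_scope.
Local Open Scope ring_scope.

(** * The scalar product and its half-spaces *)

Section DotProduct.
Context {R : realType} {d : nat}.
Implicit Types (u v w x y z : 'rV[R]_d) (V A : {fset 'rV[R]_d}).

Lemma dotpC u v : dotp u v = dotp v u.
Proof. by apply: eq_bigr => i _; rewrite mulrC. Qed.

Lemma dotpDr w x y : dotp w (x + y) = dotp w x + dotp w y.
Proof. by rewrite -big_split; apply: eq_bigr => i _; rewrite mxE mulrDr. Qed.

Lemma dotpZr w t x : dotp w (t *: x) = t * dotp w x.
Proof. by rewrite mulr_sumr; apply: eq_bigr => i _; rewrite mxE mulrCA. Qed.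

Lemma dotpDl w x y : dotp (x + y) w = dotp x w + dotp y w.
Proof. by rewrite !(dotpC _ w) dotpDr. Qed.

Lemma dotpZl w t x : dotp (t *: x) w = t * dotp x w.
Proof. by rewrite !(dotpC _ w) dotpZr. Qed.

Lemma dotp0r w : dotp w 0 = 0.
Proof. by rewrite -(scale0r w) dotpZr mul0r. Qed.

Lemma dotpNl w x : dotp (- x) w = - dotp x w.
Proof. by rewrite -scaleN1r dotpZl mulN1r. Qed.

Lemma dotpNr w x : dotp w (- x) = - dotp w x.
Proof. by rewrite !(dotpC w) dotpNl. Qed.

Lemma dotp_sumr w V (c : 'rV[R]_d -> R) :
  dotp w (\sum_(v <- V) c v *: v) = \sum_(v <- V) c v * dotp w v.
Proof.
elim: (V : seq _) => [|v s IHs]; first by rewrite !big_nil dotp0r.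
by rewrite !big_cons dotpDr IHs dotpZr.
Qed.

Lemma dotp_suml w V (c : 'rV[R]_d -> R) :
  dotp (\sum_(v <- V) c v *: v) w = \sum_(v <- V) c v * dotp v w.
Proof. by rewrite dotpC dotp_sumr; under eq_bigr do rewrite dotpC. Qed.

Lemma dotp_gt0 x : x != 0 -> 0 < dotp x x.
Proof.
move=> x0; have [i xi0] : exists i, x 0 i != 0.
  apply/existsP; apply: contraR x0; rewrite negb_exists => /forallP x0.
  by apply/eqP/rowP => i; rewrite mxE; apply/eqP; rewrite -[_ == _]negbK.
rewrite /dotp (bigD1 i) //= ltr_pwDl //; last first.
  by apply: sumr_ge0 => j _; rewrite -expr2 sqr_ge0.
by rewrite -expr2 exprn_even_gt0.
Qed.

Lemma continuous_dotp w : continuous (dotp w).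
Proof.
rewrite (_ : dotp w = fun x => \sum_(i < d) w 0 i * x 0 i) //.
have H (s : seq 'I_d) :
    continuous (fun x : 'rV[R]_d => \sum_(i <- s) w 0 i * x 0 i).
  elim: s => [|i s IHs].
    rewrite (_ : (fun _ => _) = cst 0); last first.
      by apply/funext => x; rewrite big_nil.
    exact: cst_continuous.
  rewrite (_ : (fun _ => _) =
      (fun x => w 0 i * x 0 i + \sum_(j <- s) w 0 j * x 0 j)); last first.
    by apply/funext => x; rewrite big_cons.
  move=> x; apply: (@continuousD _ _ 'rV[R]_d (fun y => w 0 i * y 0 i)
    (fun y => \sum_(j <- s) w 0 j * y 0 j)); last exact: IHs.
  apply: (@continuousM _ 'rV[R]_d (fun=> w 0 i) (fun y => y 0 i)).
    exact: cst_continuous.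
  exact: coord_continuous.
exact: H.
Qed.

Lemma open_dotp_gt u (b : R) : open [set y | b < dotp u y].
Proof. by have /continuousP/(_ _ (@open_gt R b)) := @continuous_dotp u. Qed.

Lemma open_dotp_lt u (b : R) : open [set y | dotp u y < b].
Proof. by have /continuousP/(_ _ (@open_lt R b)) := @continuous_dotp u. Qed.

Lemma closed_dotp_le u (b : R) : closed [set y | dotp u y <= b].
Proof.
by rewrite -openC (_ : ~` _ = [set y | b < dotp u y]);
  [exact: open_dotp_gt|apply/seteqP; split => y /=; rewrite ltNge => /negP].
Qed.

End DotProduct.

(** * Gordan's alternative and separation from a convex hull *)

Section Separation.
Context {R : realType} {d : nat}.
Implicit Types (u v w x y z : 'rV[R]_d) (V A : {fset 'rV[R]_d}).

Lemma perturb_lt0 (s : seq 'rV[R]_d) p q :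
  (forall a, a \in s -> dotp a p < 0) ->
  exists2 e : R, 0 < e & forall a, a \in s -> dotp a (p + e *: q) < 0.
Proof.
(* Asking for every step length [t] in []0, e]] lets the induction take a minimum. *)
move=> sp; suff [e e0 es] : exists2 e : R, 0 < e &
    forall a t, a \in s -> 0 < t <= e -> dotp a (p + t *: q) < 0.
  by exists e => // a /es; apply; rewrite e0 lexx.
elim: s sp => [|b s IHs] sp; first by exists 1.
have [|e e0 es] := IHs; first by move=> a sa; apply: sp; rewrite inE sa orbT.
have bp : dotp b p < 0 by apply: sp; rewrite mem_head.
(* For [0 < t <= f] this gives [dotp b (p + t *: q) <= - t]: the summand 1 keeps the denominator
   positive and leaves the strict margin. *)
pose f := - dotp b p / (1 + `|dotp b q|).
have q0 : 0 < 1 + `|dotp b q| by rewrite ltr_pwDl.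
have f0 : 0 < f by rewrite divr_gt0 ?oppr_gt0.
exists (Num.min e f); first by rewrite lt_min e0.
move=> a t; rewrite inE le_min => /predU1P[->|sa] /and3P[t0 te tf]; last first.
  by apply: es; rewrite ?t0.
rewrite dotpDr dotpZr.
move: tf; rewrite ler_pdivlMr // mulrDr mulr1 => tf.
have := ler_wpM2l (ltW t0) (ler_norm (dotp b q)); lra.
Qed.

(* Gordan's alternative.  If the half-space of u given by the induction
   hypothesis misses b, the other vectors are replaced by positive combinations
   with b that are orthogonal to u. *)
Lemma gordan (C : set 'rV[R]_d) (s : seq 'rV[R]_d) :
  (forall x y, C x -> C y -> C (x + y)) ->
  (forall t x, 0 < t -> C x -> C (t *: x)) -> ~ C 0 ->
  (forall a, a \in s -> C a) ->
  exists u, forall a, a \in s -> dotp a u < 0.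
Proof.
move=> CD CZ C0; have [m] := ubnP (size s).
elim: m s => // m IHm [|b s] /= sm Cs; first by exists 0.
have Cb : C b by apply: Cs; rewrite mem_head.
have {}Cs a : a \in s -> C a by move=> sa; apply: Cs; rewrite inE sa orbT.
have b0 : 0 < dotp b b.
  by apply/dotp_gt0/eqP => b0; apply: C0; rewrite -b0.
have [//|u us] := IHm s _ Cs.
have [bu|bu|bu] := ltgtP (dotp b u) 0.
- by exists u => a; rewrite inE => /predU1P[->|/us].
- pose f a := dotp b u *: a - dotp a u *: b.
  have [||v vs] := IHm (map f s).
  + by rewrite size_map.
  + move=> _ /mapP[a sa ->]; rewrite /f -scaleNr.
    by apply: CD; apply: CZ; rewrite ?oppr_gt0 ?us //; exact: Cs.
  (* [v'] is orthogonal to [b], and [dotp b u * dotp a v'] equals [dotp (f a) v], so [v'] is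
     negative on [s]. A small step along [- u] then makes [b] negative too. *)
  pose v' := v - (dotp b v / dotp b u) *: u.
  have [|e e0 es] := @perturb_lt0 s v' (- u).
    move=> a sa; have /vs := map_f f sa.
    rewrite /f /v' dotpDl dotpNl !dotpZl dotpDr dotpNr dotpZr => H.
    rewrite -(pmulr_rlt0 _ bu); apply: le_lt_trans H.
    by rewrite le_eqVlt; apply/orP; left; apply/eqP; field; exact: lt0r_neq0.
  exists (v' + e *: - u) => a; rewrite inE => /predU1P[->|/es//].
  rewrite /v' !dotpDr dotpNr !dotpZr dotpNr mulfVK ?gt_eqF// subrr add0r.
  by rewrite mulrN oppr_lt0 mulr_gt0.
(* Here [u] is orthogonal to [b], and a small step along [- b] suffices. *)
- have [e e0 es] := perturb_lt0 (- b) us.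
  exists (u + e *: - b) => a; rewrite inE => /predU1P[->|/es//].
  by rewrite dotpDr bu add0r dotpZr dotpNr mulrN oppr_lt0 mulr_gt0.
Qed.

Lemma chull_convex V x y (t : R) : 0 <= t <= 1 -> chull V x -> chull V y ->
  chull V (t *: x + (1 - t) *: y).
Proof.
move=> /andP[t0 t1] [c [c0 c1 ->]] [c' [c'0 c'1 ->]].
exists (fun v => t * c v + (1 - t) * c' v); split.
- by move=> v vV; rewrite addr_ge0 ?mulr_ge0 ?subr_ge0 ?c0 ?c'0.
- by rewrite big_split /= -!mulr_sumr c1 c'1 !mulr1 addrC subrK.
- rewrite !scaler_sumr -big_split /=; apply: eq_bigr => v _.
  by rewrite !scalerA -scalerDl.
Qed.

Lemma mem_chull V v : v \in V -> chull V v.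
Proof.
move=> vV; exists (fun x => (x == v)%:R); split => //.
- rewrite (big_fsetD1 v) //= eqxx big_seq big1 ?addr0 // => x.
  by rewrite !inE => /andP[/negPf->].
- rewrite (big_fsetD1 v) //= eqxx scale1r big_seq big1 ?addr0 // => x.
  by rewrite !inE => /andP[/negPf-> _]; rewrite scale0r.
Qed.

(** The positive multiples of [x - w], for [x] in the hull, form a convex cone. It avoids 0 because
    [w] is outside the hull, so Gordan's alternative applies to the vectors [v - w]. *)
Lemma chull_separation V w : ~ chull V w ->
  exists u, forall v, v \in V -> dotp v u < dotp w u.
Proof.
move=> Vw.
pose C := [set y | exists2 t : R, 0 < t &
  exists2 x, chull V x & y = t *: (x - w)].
have [||||u us] := @gordan C (map (fun v => v - w) V).
- move=> _ _ [t t0 [x Vx ->]] [r r0 [y Vy ->]].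
  have tr0 : 0 < t + r by rewrite addr_gt0.
  exists (t + r) => //; exists (t / (t + r) *: x + (1 - t / (t + r)) *: y).
    apply: chull_convex => //.
    by rewrite divr_ge0 ?(ltW t0) ?(ltW tr0) //= ler_pdivrMr // mul1r lerDl ltW.
  apply/rowP => i; rewrite !mxE; field; exact: lt0r_neq0.
- move=> t _ t0 [r r0 [x Vx ->]]; exists (t * r); first exact: mulr_gt0.
  by exists x => //; rewrite scalerA.
- move=> [t t0 [x Vx /eqP]]; rewrite eq_sym scaler_eq0 gt_eqF //= subr_eq0.
  by move=> /eqP xw; apply: Vw; rewrite -xw.
- move=> _ /mapP[v vV ->]; exists 1 => //; exists v; last by rewrite scale1r.
  exact: mem_chull.
exists u => v vV; have /us := map_f (fun v => v - w) vV.
by rewrite dotpDl dotpNl subr_lt0.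
Qed.

Lemma chull_le V x u (b : R) : (forall v, v \in V -> dotp v u <= b) ->
  chull V x -> dotp x u <= b.
Proof.
move=> Vb [c [c0 c1 ->]]; rewrite dotp_suml -(mul1r b) -c1 mulr_suml.
rewrite big_seq [leRHS]big_seq; apply: ler_sum => v vV.
by rewrite ler_wpM2l ?c0 ?Vb.
Qed.

(** Equality would make a sum of nonnegative terms [c v * (b - dotp v u)] vanish, hence every weight
    [c v], although the weights sum to 1. *)
Lemma chull_lt V x u (b : R) : (forall v, v \in V -> dotp v u < b) ->
  chull V x -> dotp x u < b.
Proof.
move=> Vb Vx; rewrite lt_neqAle (chull_le _ Vx) ?andbT; last first.
  by move=> v /Vb /ltW.
case: Vx => c [c0 c1 ->]; apply/negP => /eqP; rewrite dotp_suml => cb.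
have : \sum_(v <- V) c v * (b - dotp v u) = 0.
  under eq_bigr do rewrite mulrBr.
  by rewrite sumrB cb -mulr_suml c1 mul1r subrr.
move=> /eqP; rewrite big_seq psumr_eq0; last first.
  by move=> v vV; rewrite mulr_ge0 ?c0 // subr_ge0 ltW ?Vb.
move=> /allP cz; move: c1; rewrite big_seq big1 => [|v vV].
  by move/eqP; rewrite eq_sym oner_eq0.
have /implyP := cz _ vV.
by move=> /(_ vV); rewrite mulf_eq0 subr_eq0 (gt_eqF (Vb _ vV)) orbF => /eqP.
Qed.

(** The finitely many strict inequalities separating an outside point from the vertices persist near
    it, and by [chull_lt] they keep a point out of the hull. *)
Lemma closed_chull V : closed (chull V).
Proof.
rewrite -openC openE => x /chull_separation[u xu].
have H : nbhs x (\bigcap_(v in [set` V]) [set y | dotp v u < dotp y u]).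
  apply: filter_bigI => v /xu; rewrite (dotpC x) => vx.
  have := open_nbhs_nbhs (conj (@open_dotp_gt R d u (dotp v u)) vx).
  by apply: filterS => y /=; rewrite (dotpC u).
rewrite /interior; apply: filterS H => y Hy Vy.
by have := chull_lt Hy Vy; rewrite ltxx.
Qed.

End Separation.

(** * Barycentric coordinates and faces of one simplex *)

Section Simplices.
Context {R : realType} {d : nat}.
Implicit Types (u v w x y z : 'rV[R]_d) (V A B S T : {fset 'rV[R]_d}).

Lemma nbhs_ray z y (U : set 'rV[R]_d) : nbhs z U ->
  exists2 t : R, 0 < t <= 1 & U (z + t *: y).
Proof.
move=> /nbhs_ballP[e /= e0 zU]; pose M := \sum_(j < d) `|y 0 j|.
have M0 : 0 <= M by apply: sumr_ge0.
have s0 : 0 < e + 1 + M by lra.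
(* Since each [|y 0 j|] is at most [M], this step moves every coordinate by less than [e], and balls
   are coordinatewise. *)
exists (e / (e + 1 + M)).
  by rewrite divr_gt0 //= ler_pdivrMr //; lra.
apply: zU; split=> // i j; rewrite ord1 !mxE /ball /=.
rewrite opprD addNKr normrN normrM gtr0_norm ?divr_gt0 //.
rewrite mulrAC ltr_pdivrMr // ltr_pM2l //.
have : `|y 0 j| <= M by rewrite /M (bigD1 j) //= lerDl sumr_ge0.
by lra.
Qed.

Lemma sum_fset_mask (M : nmodType) A B (F : 'rV[R]_d -> M) :
  (A `<=` B)%fset ->
  \sum_(v <- B) (if v \in A then F v else 0) = \sum_(v <- A) F v.
Proof.
move=> AB; rewrite -(big_fset_incl _ AB) => [|v _ /negPf->//].
by rewrite big_seq [RHS]big_seq; apply: eq_bigr => v ->.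
Qed.

Lemma sum_fset_maskZ A B (c : 'rV[R]_d -> R) : (A `<=` B)%fset ->
  \sum_(v <- B) (if v \in A then c v else 0) *: v = \sum_(v <- A) c v *: v.
Proof.
move=> AB; rewrite -(sum_fset_mask (fun v => c v *: v) AB).
by apply: eq_bigr => v _; case: ifP => // _; rewrite scale0r.
Qed.

Lemma chull_mono A B : (A `<=` B)%fset -> chull A `<=` chull B.
Proof.
move=> AB x [c [c0 c1 ->]]; exists (fun v => if v \in A then c v else 0).
split; [|by rewrite sum_fset_mask|by rewrite sum_fset_maskZ].
by move=> v _; case: ifPn => // /c0.
Qed.

(** Barycentric coordinates in [V] are unique: a relative interior point of the face [A] has
    positive coordinates on [A], while a point of the face [B] has none outside [B]. *)
Lemma aff_independent_face V A B (c : 'rV[R]_d -> R) :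
  aff_independent V -> (A `<=` V)%fset -> (B `<=` V)%fset ->
  (forall v, v \in A -> 0 < c v) -> \sum_(v <- A) c v = 1 ->
  chull B (\sum_(v <- A) c v *: v) -> (A `<=` B)%fset.
Proof.
move=> indV AV BV c0 c1 [c' [_ c'1 cc']]; apply/fsubsetP => a aA.
pose e v := (if v \in A then c v else 0) - (if v \in B then c' v else 0).
have e1 : \sum_(v <- V) e v = 0.
  by rewrite sumrB !sum_fset_mask // c1 c'1 subrr.
have e2 : \sum_(v <- V) e v *: v = 0.
  under eq_bigr do rewrite scalerBl.
  by rewrite sumrB !sum_fset_maskZ // cc' subrr.
have := indV e e1 e2 a (fsubsetP AV _ aA).
rewrite /e aA; case: ifPn => // _ /eqP.
by rewrite subr0 gt_eqF // c0.
Qed.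

Lemma relint_near0 T (U : set 'rV[R]_d) : 0 \in T -> nbhs (0 : 'rV[R]_d) U ->
  exists c : 'rV[R]_d -> R, [/\ forall v, v \in T -> 0 < c v,
    \sum_(v <- T) c v = 1 & U (\sum_(v <- T) c v *: v)].
Proof.
move=> T0 U0; pose N : R := #|` T|%:R.
have N0 : 0 < N by rewrite ltr0n cardfs_gt0; apply/fset0Pn; exists 0.
have [t /andP[t0 t1]] := nbhs_ray (N^-1 *: \sum_(v <- T) v) U0.
rewrite add0r scalerA => Ut.
(* The barycenter of [T] is shrunk towards 0; the missing weight [1 - t] goes to the vertex 0, which
   does not change the point. *)
exists (fun v => t / N + (1 - t) * (v == 0)%:R); split.
- by move=> v _; rewrite ltr_pwDl ?divr_gt0 // mulr_ge0 // subr_ge0.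
- have -> : \sum_(v <- T) (t / N + (1 - t) * (v == 0)%:R) =
      \sum_(v <- T) t / N + (1 - t) * \sum_(v <- T) (v == 0)%:R.
    by rewrite mulr_sumr big_split.
  have -> : \sum_(v <- T) (v == 0)%:R = 1 :> R.
    rewrite (big_fsetD1 0) //= eqxx big_seq big1 ?addr0 // => v.
    by rewrite !inE => /andP[/negPf->].
  rewrite big_const_seq count_predT iter_addr_0 -mulr_natr -/N.
  by rewrite mulr1 mulfVK ?gt_eqF // addrC subrK.
- rewrite (_ : \sum_(v <- T) _ = (t / N) *: \sum_(v <- T) v) //.
  rewrite scaler_sumr; apply: eq_bigr => v _.
  rewrite scalerDl; case: eqP => [->|_]; first by rewrite !scaler0 addr0.
  by rewrite mulr0 scale0r addr0.
Qed.

End Simplices.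

(** * Faces of the star and its shape near a face *)

Section Star.
Context {R : realType} {d : nat} {K : {fset {fset 'rV[R]_d}}}.
Hypothesis hK : star K.
Implicit Types (u v w x y z : 'rV[R]_d) (V A B S T : {fset 'rV[R]_d}).

Lemma star_face0 V T : V \in K -> (T `<=` V)%fset -> chull T 0 -> 0 \in T.
Proof.
move=> VK TV T0; have [indV _] := star_simplex hK VK.
have /fsubsetP : ([fset 0] `<=` T)%fset.
  apply: (@aff_independent_face _ _ V _ _ (fun=> 1)) => //.
  - by apply/fsubsetP => v; rewrite inE => /eqP ->; exact: (star_vertex hK VK).
  - by rewrite big_seq_fset1.
  - by rewrite big_seq_fset1 scaler0.
by apply; rewrite inE.
Qed.

(** Conformity puts the relative interior point of [T] in a common face [F] of [V0] and [V];
    uniqueness of coordinates in [V0] then gives [T] inside [F]. *)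
Lemma star_face_sub V0 V T (c : 'rV[R]_d -> R) :
  V0 \in K -> V \in K -> (T `<=` V0)%fset ->
  (forall v, v \in T -> 0 < c v) -> \sum_(v <- T) c v = 1 ->
  chull V (\sum_(v <- T) c v *: v) -> (T `<=` V)%fset.
Proof.
move=> V0K VK TV0 c0 c1 Vz; have [indV0 _] := star_simplex hK V0K.
have [F [FV0 FV VF]] := star_conforming hK V0K VK.
apply: fsubset_trans FV; apply: (aff_independent_face indV0 TV0 FV0 c0 c1).
rewrite -VF; split => //; apply: chull_mono TV0 _ _.
by exists c; split => // v /c0 /ltW.
Qed.

(** Passes between geometric inclusion, used in the definitions, and inclusion of vertex sets, used
    in the proofs; one relative interior point of [T] decides. *)
Lemma chull_subset V0 V T S : V0 \in K -> V \in K ->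
  (T `<=` V0)%fset -> (S `<=` V)%fset -> 0 \in T ->
  chull T `<=` chull S <-> (T `<=` S)%fset.
Proof.
move=> V0K VK TV0 SV T0; split=> [TS|]; last exact: chull_mono.
have [c [c0 c1 _]] := relint_near0 T0 filterT.
have Sz : chull S (\sum_(v <- T) c v *: v).
  by apply: TS; exists c; split => // v /c0 /ltW.
have TV : (T `<=` V)%fset.
  by apply: (star_face_sub V0K VK TV0 c0 c1); exact: chull_mono SV _ Sz.
have [indV _] := star_simplex hK VK.
exact: (aff_independent_face indV TV SV c0 c1 Sz).
Qed.

(** Take [z] in the relative interior of [T] and in the interior of the star. The finitely many
    simplices not containing [T] are closed and miss [z], so they also miss a neighbourhood of
    it. *)
Lemma star_local_point V0 T : V0 \in K -> (T `<=` V0)%fset -> 0 \in T ->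
  exists2 z, chull T z & forall y, exists t V,
    [/\ 0 < t <= 1, V \in K, (T `<=` V)%fset & chull V (z + t *: y)].
Proof.
move=> V0K TV0 T0.
have := @open_nbhs_nbhs _ (0 : 'rV[R]_d) _
  (conj (@open_interior _ (Defs.support K)) (star_interior hK)).
move=> /(relint_near0 T0)[c [c0 c1]]; set z := \sum_(v <- T) _ => Kz.
exists z; first by exists c; split => // v /c0 /ltW.
move=> y.
have zU : nbhs z (\bigcap_(V in [set` K])
    [set x | (T `<=` V)%fset \/ ~ chull V x]).
  apply: filter_bigI => V VK; have [TV|TV] := boolP (T `<=` V)%fset.
    by apply: filterS filterT => x _; left.
  have /open_nbhs_nbhs : open_nbhs z (~` chull V).
    split; first by rewrite openC; exact: closed_chull.
    by move=> /(star_face_sub V0K VK TV0 c0 c1); exact/negP.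
  by apply: filterS => x; right.
have [t t01 [[V VK Vt] /(_ _ VK)[TV|//]]] := nbhs_ray y (filterI Kz zU).
by exists t, V; split.
Qed.

End Star.

(** * The convex function, its dual sets and their relative boundaries *)

Section ConvexStar.
Context {R : realType} {d : nat} {K : {fset {fset 'rV[R]_d}}}.
Context {gamma : 'rV[R]_d -> R}.
Hypotheses (hK : star K) (hconv : convex_on_star K gamma).
Hypotheses (haff : piecewise_affine K gamma) (hgamma0 : gamma 0 = 0).
Implicit Types (u v w x y z : 'rV[R]_d) (V A B S T : {fset 'rV[R]_d}).

(** [gamma] agrees with a convex function on the star only, and a star may fail to be convex, hence
    the condition on the intermediate point. *)
Lemma convex_on_star_le (t : R) x z : 0 <= t <= 1 ->
  Defs.support K x -> Defs.support K z -> Defs.support K (z + t *: (x - z)) ->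
  gamma (z + t *: (x - z)) <= (1 - t) * gamma z + t * gamma x.
Proof.
move=> /andP[t0 t1] Kx Kz Kt; have [g gconv gE] := hconv; rewrite !gE //.
have -> : z + t *: (x - z) = t *: x + (1 - t) *: z.
  by apply/rowP => i; rewrite !mxE; ring.
have := gconv (Itv01 t0 t1) x z; rewrite !inE => /(_ I I) gle.
by rewrite [leRHS]addrC; exact: gle.
Qed.

Lemma gamma_linear V : V \in K ->
  exists a, forall x, chull V x -> gamma x = dotp a x.
Proof.
move=> VK; have [a [b ab]] := (proj2 haff) V VK.
have V0 := mem_chull (star_vertex hK VK).
exists a => x /ab; have := ab _ V0; rewrite hgamma0 dotp0r add0r => <-.
by rewrite addr0.
Qed.

Lemma support_chull V x : V \in K -> chull V x -> Defs.support K x.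
Proof. by move=> VK Vx; exists V. Qed.

Lemma local_star_mem T V x : V \in K -> (T `<=` V)%fset -> chull V x ->
  local_star K T x.
Proof. by move=> VK TV Vx; exists V => //; split => //; exact: chull_mono. Qed.

Lemma local_star_support T x : local_star K T x -> Defs.support K x.
Proof. by case=> V [VK _] Vx; exists V. Qed.

Lemma dual_plane_vertices V T w : V \in K -> (T `<=` V)%fset ->
  dual_plane gamma T w <-> (forall v, v \in T -> dotp w v = gamma v).
Proof.
move=> VK TV; split=> [wT v vT|wT z Tz]; first exact/wT/mem_chull.
have [a aV] := gamma_linear VK.
have {}aV x : chull T x -> gamma x = dotp a x.
  by move=> Tx; apply/aV/(chull_mono TV).
rewrite aV //; case: Tz => c [_ _ ->]; rewrite !dotp_sumr.
rewrite big_seq [RHS]big_seq; apply: eq_bigr => v vT.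
by rewrite wT // aV //; exact: mem_chull.
Qed.

Lemma local_subdiff0 V0 T w : V0 \in K -> (T `<=` V0)%fset -> 0 \in T ->
  dual_plane gamma T w -> (forall x, local_star K T x -> dotp w x <= gamma x) ->
  subdiff0 K gamma w.
Proof.
move=> V0K TV0 T0 wT wle x Kx.
have [z Tz zloc] := star_local_point hK V0K TV0 T0.
have [t [V [/andP[t0 t1] VK TV Vt]]] := zloc (x - z).
have Kz : Defs.support K z by exists V0 => //; exact: chull_mono Tz.
have t01 : 0 <= t <= 1 by rewrite ltW.
have := convex_on_star_le t01 Kx Kz (support_chull VK Vt).
have := wle _ (local_star_mem VK TV Vt).
rewrite dotpDr dotpZr dotpDr dotpNr wT // => le1 le2.
(* As [gamma z] equals [dotp w z], chaining [le1] and [le2] leaves [t * dotp w x <= t * gamma x]. *)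
rewrite -(ler_pM2l t0); lra.
Qed.

(** The case [T = V] of [local_subdiff0]: all members of [K] have equally many vertices, so the
    local star of [V] is [V] alone. *)
Lemma gamma_linear_subdiff0 V a : V \in K ->
  (forall x, chull V x -> gamma x = dotp a x) -> subdiff0 K gamma a.
Proof.
move=> VK aV; have V0 := star_vertex hK VK.
apply: (local_subdiff0 VK (fsubset_refl V) V0) => [x Vx|x]; first by rewrite aV.
move=> [W [WK VW] Wx]; suff VeW : V = W by rewrite aV // VeW.
have {}VW : (V `<=` W)%fset.
  exact/(chull_subset hK VK WK (fsubset_refl V) (fsubset_refl W) V0).
apply/eqP; rewrite eqEfcard VW.
by rewrite (star_simplex hK VK).2 (star_simplex hK WK).2 /=.
Qed.

Lemma dual_set_polytope V0 T : V0 \in K -> (T `<=` V0)%fset -> 0 \in T ->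
  polytope (dual_set K gamma T).
Proof.
move=> V0K TV0 T0.
(* [f V] is the gradient of [gamma] on [V], with a dummy value off [K]. *)
have /choice [f fP] : forall V, exists a, V \in K ->
    forall x, chull V x -> gamma x = dotp a x.
  move=> V; have [VK|VK] := boolP (V \in K); last by exists 0.
  by have [a aV] := gamma_linear VK; exists a.
exists [fset f V | V in K & (T `<=` V)%fset]%fset.
apply/seteqP; split => w; last first.
  move=> Ew; split.
    move=> x Kx; apply: chull_le Ew => _ /imfsetP[V /= + ->].
    rewrite !inE => /andP[VK TV].
    exact: (gamma_linear_subdiff0 VK (fP V VK)).
  apply/(dual_plane_vertices _ V0K TV0) => v vT; apply/eqP.
  rewrite eq_le; apply/andP; split.
    apply: chull_le Ew => _ /imfsetP[V /= + ->]; rewrite !inE => /andP[VK TV].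
    by rewrite -fP //; apply: mem_chull; exact: (fsubsetP TV).
  (* [chull_le] only bounds from above, so the lower bound is taken in direction [- v]. *)
  rewrite -lerN2 -dotpNr.
  apply: chull_le Ew => _ /imfsetP[V /= + ->]; rewrite !inE => /andP[VK TV].
  by rewrite dotpNr -fP //; apply: mem_chull; exact: (fsubsetP TV).
(* The point [z + t *: u] lies in some [V] containing [T]. There the subgradient inequality, with
   equality at [z], gives [dotp w u <= dotp (f V) u], against the separation. *)
move=> [wK wT]; apply: contrapT => /chull_separation[u uw].
have [z Tz zloc] := star_local_point hK V0K TV0 T0.
have [t [V [/andP[t0 t1] VK TV Vt]]] := zloc u.
have Vz := chull_mono TV Tz.
have := wK _ (support_chull VK Vt).
rewrite (fP V VK) // !dotpDr !dotpZr wT // (fP V VK z Vz) lerD2l ler_pM2l //.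
by rewrite leNgt uw //; apply/imfsetP; exists V => //=; rewrite !inE VK.
Qed.

Lemma closed_dual_set V T : V \in K -> (T `<=` V)%fset ->
  closed (dual_set K gamma T).
Proof.
(* An intersection of closed half-spaces; the second family holds only the reverse inequalities on
   [T], the first giving the direct ones. *)
move=> VK TV; rewrite (_ : dual_set _ _ _ =
  (\bigcap_(x in Defs.support K) [set w | dotp x w <= gamma x]) `&`
  (\bigcap_(x in chull T) [set w | dotp (- x) w <= - gamma x])).
  by apply: closedI; apply: closed_bigI => x _; exact: closed_dotp_le.
apply/seteqP; split => w [wK wT]; split => x.
- by move=> /wK; rewrite dotpC.
- by move=> /wT/=; rewrite dotpNl dotpC => ->.
- by move=> /wK; rewrite /= dotpC.
- move=> Tx; apply/eqP; rewrite eq_le; apply/andP; split.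
    by rewrite dotpC; apply: wK; exists V => //; exact: chull_mono Tx.
  by have := wT _ Tx; rewrite /= dotpNl lerN2 dotpC.
Qed.

Lemma orthogonal_direction V T v : V \in K -> (T `<=` V)%fset -> 0 \in T ->
  v \in V -> v \notin T ->
  exists2 q, (forall x, x \in T -> dotp q x = 0) & dotp q v = 1.
Proof.
move=> VK TV T0 vV vT; have [indV _] := star_simplex hK VK.
pose A := \matrix_(i < #|` T|) nth 0 T i.
(* As 0 is a vertex of [V], affine independence makes the nonzero vertices linearly independent, so
   [v] is not in the span of [T]. *)
have vA : ~~ (v <= A)%MS.
  apply/negP => /submxP[D]; rewrite mulmx_sum_row => vE.
  pose e x := \sum_(i < #|` T|) D 0 i * (nth 0 T i == x)%:R.
  have eE : \sum_(x <- T) e x *: x = v.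
    rewrite vE; under eq_bigr do rewrite scaler_suml.
    rewrite exchange_big; apply: eq_bigr => i _; rewrite rowK.
    rewrite (big_fsetD1 (nth 0 T i)) ?mem_nth //= eqxx mulr1.
    rewrite big_seq big1 ?addr0 // => x.
    by rewrite !inE eq_sym => /andP[/negPf-> _]; rewrite mulr0 scale0r.
  pose s := \sum_(x <- T) e x - 1.
  have v0 : v != 0 by apply: contraNneq vT => ->.
  have V0 := fsubsetP TV _ T0.
  have pick (M : lmodType R) y (F : _ -> M) : y \in V ->
      \sum_(x <- V) (x == y)%:R *: F x = F y.
    move=> yV; rewrite (big_fsetD1 y) //= eqxx scale1r.
    rewrite big_seq big1 ?addr0 // => x.
    by rewrite !inE => /andP[/negPf-> _]; rewrite scale0r.
  (* The linear relation for [v] becomes an affine one: the weight [s] at 0 brings the total to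
     zero. The coefficient at [v] stays 1. *)
  pose c x := (x == v)%:R - (if x \in T then e x else 0) + s * (x == 0)%:R.
  have : c v = 0.
    apply: indV => //.
    - rewrite big_split sumrB /= sum_fset_mask // -mulr_sumr.
      have pick1 y : y \in V -> \sum_(x <- V) (x == y)%:R = 1 :> R.
        move=> yV; rewrite -[RHS](pick R^o y (fun=> 1)) //.
        by apply: eq_bigr => x _; rewrite /GRing.scale /= mulr1.
      by rewrite !pick1 // mulr1 /s; ring.
    - under eq_bigr do rewrite scalerDl scalerBl -scalerA.
      rewrite big_split sumrB /= sum_fset_maskZ // -scaler_sumr.
      by rewrite !pick // eE subrr scaler0 addr0.
  rewrite /c eqxx (negPf vT) (negPf v0) subr0 mulr0 addr0 => /eqP.
  by rewrite oner_eq0.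
(* The columns of the cokernel are orthogonal to [T]; one that is not orthogonal to [v], rescaled,
   is [q]. *)
move: vA; rewrite submxE => vA.
have [j vj] : exists j, (v *m cokermx A) 0 j != 0.
  apply/existsP; apply: contraR vA; rewrite negb_exists => /forallP vA.
  by apply/eqP/rowP => i; rewrite (eqP (negbNE (vA i))) mxE.
have qE x : dotp (col j (cokermx A))^T x = (x *m cokermx A) 0 j.
  by rewrite mxE; apply: eq_bigr => i _; rewrite !mxE mulrC.
exists (((v *m cokermx A) 0 j)^-1 *: (col j (cokermx A))^T) => [x xT|].
  rewrite dotpZl qE; have xsz : (index x T < #|` T|)%N by rewrite index_mem.
  have -> : x = row (Ordinal xsz) A by rewrite rowK /= nth_index.
  by rewrite -row_mul mulmx_coker !mxE mulr0.
by rewrite dotpZl qE mulVf.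
Qed.

Lemma dual_set_mono V S T : V \in K -> (S `<=` V)%fset -> (T `<=` S)%fset ->
  dual_set K gamma S `<=` dual_set K gamma T.
Proof.
by move=> VK SV TS w [wK wS]; split => // x Tx; apply: wS; exact: chull_mono Tx.
Qed.

Lemma dual_set_not_interior V S T w : V \in K -> (S `<=` V)%fset ->
  (T `<` S)%fset -> 0 \in T -> dual_set K gamma S w ->
  ~ interior (dual_set K gamma T : set (subspace (dual_plane gamma T))) w.
Proof.
move=> VK SV TS T0 wS.
have TS' := fproper_sub TS; have TV := fsubset_trans TS' SV.
have [wK wT] := dual_set_mono VK SV TS' wS.
have [v vS vT] : exists2 v, v \in S & v \notin T.
  by move: TS; rewrite fproperE => /andP[_ /fsubsetPn].
have vV := fsubsetP SV _ vS.
have [q qT qv] := orthogonal_direction VK TV T0 vV vT.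
rewrite /interior => /(nbhs_subspace_ex _ wT)[U wU UE].
have [t /andP[t0 _] Ut] := nbhs_ray q wU.
have wtT : dual_plane gamma T (w + t *: q).
  apply/(dual_plane_vertices _ VK TV) => x xT.
  by rewrite dotpDl dotpZl qT // mulr0 addr0 wT //; exact: mem_chull.
have [[wtK _] _] : (dual_set K gamma T `&` dual_plane gamma T) (w + t *: q).
  by rewrite UE.
have := wtK _ (support_chull VK (mem_chull vV)).
rewrite dotpDl dotpZl qv mulr1 wS.2; last exact: mem_chull.
by rewrite gerDl leNgt t0.
Qed.

Lemma dual_set_interior V0 T w : V0 \in K -> (T `<=` V0)%fset -> 0 \in T ->
  dual_set K gamma T w ->
  (forall V v, V \in K -> (T `<=` V)%fset -> v \in V -> v \notin T ->
     dotp w v != gamma v) ->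
  interior (dual_set K gamma T : set (subspace (dual_plane gamma T))) w.
Proof.
move=> V0K TV0 T0 [wK wT] wlt.
pose U := \bigcap_(V in [set` K]) \bigcap_(v in [set` V])
  [set y | (T `<=` V)%fset -> v \notin T -> dotp v y < gamma v].
rewrite /interior; apply/(nbhs_subspace_ex _ wT).
(* The trace on the plane must be exactly the dual set: the union contains the neighbourhood [U],
   and the trace of [U] lies in the dual set. *)
exists (dual_set K gamma T `|` U); last first.
  apply/seteqP; split => y [yT yP]; split => //; first by left.
  case: yT => // yU; split => //.
  apply: (local_subdiff0 V0K TV0 T0 yP) => x [V [VK TV'] Vx].
  have TV : (T `<=` V)%fset.
    by apply/(chull_subset hK V0K VK TV0 (fsubset_refl V)).
  have [a aV] := gamma_linear VK.
  have yv v : v \in V -> dotp y v <= gamma v.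
    move=> vV; have [vT|vT] := boolP (v \in T).
      by rewrite yP //; exact: mem_chull.
    by rewrite dotpC ltW //; apply: yU VK _ vV TV vT.
  rewrite aV //; case: Vx => c [c0 _ ->]; rewrite !dotp_sumr.
  rewrite big_seq [leRHS]big_seq; apply: ler_sum => v vV.
  by rewrite ler_wpM2l ?c0 // -aV ?yv //; exact: mem_chull.
apply: (@filterS _ _ _ U); first by right.
apply: filter_bigI => V VK; apply: filter_bigI => v vV.
have [TV|TV] := boolP (T `<=` V)%fset; last exact: filterE.
have [vT|vT] := boolP (v \in T); first exact: filterE.
have : open_nbhs w [set y | dotp v y < gamma v].
  split; first exact: open_dotp_lt.
  rewrite /= dotpC lt_neqAle (wlt _ _ VK) // wK //.
  exact/(support_chull VK)/mem_chull.
by move=> /open_nbhs_nbhs; apply: filterS => y yv _ _; exact: yv.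
Qed.

End ConvexStar.

Theorem proposition5p6 (R : realType) (d : nat) (hd : (2 <= d)%N)
    (K : {fset {fset 'rV[R]_d}}) (hK : star K)
    (gamma : 'rV[R]_d -> R) (hconv : convex_on_star K gamma)
    (haff : piecewise_affine K gamma) (hgamma0 : gamma 0 = 0)
    (n : nat) (hn : (n < d)%N)
    (T : {fset 'rV[R]_d}) (hT : simplex_of K n T) (hT0 : chull T 0) :
  [/\ polytope (dual_set K gamma T),
      dual_set K gamma T =
        [set w | (forall z, chull T z -> dotp w z = gamma z) /\
                 (forall z, local_star K T z -> dotp w z <= gamma z)]
    & rel_boundary (dual_plane gamma T) (dual_set K gamma T) =
        \bigcup_(S in [set S | simplex_of K n.+1 S /\ chull T `<=` chull S])
          dual_set K gamma S].
Proof.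
have [_ [V0 V0K TV0]] := hT; have T0 := star_face0 hK V0K TV0 hT0.
split.
- exact: (dual_set_polytope hK hconv haff hgamma0 V0K TV0 T0).
- apply/seteqP; split => w [w1 w2].
    by split => // x /local_star_support; exact: w1.
  by split => //; exact: (local_subdiff0 hK hconv V0K TV0 T0 w1 w2).
- have Tcl : closed (dual_set K gamma T : set (subspace (dual_plane gamma T))).
    by apply: closed_subspaceW; exact: closed_dual_set V0K TV0.
  rewrite /rel_boundary -(closure_id _).1 //; apply/seteqP; split => w.
    move=> [wT wni]; apply: contrapT => wS; apply: wni.
    apply: (dual_set_interior hK hconv haff hgamma0 V0K TV0 T0 wT).
    move=> V v VK TV vV vT; apply/negP => /eqP wv; apply: wS.
    (* Equality at [v] places [w] in the dual set of the face obtained by adding [v] to [T]. *)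
    have SV : (v |` T `<=` V)%fset by rewrite fsubUset fsub1set vV.
    exists (v |` T)%fset.
      split; last by apply: chull_mono; exact: fsubsetU1.
      by split; [rewrite cardfsU1 vT hT.1|exists V].
    split; first exact: wT.1.
    apply/(dual_plane_vertices hK haff hgamma0 _ VK SV) => x.
    rewrite !inE => /predU1P[->//|xT]; apply: wT.2; exact: mem_chull.
  move=> [S [[Scard [V VK SV]]]].
  move=> /(chull_subset hK V0K VK TV0 SV T0) TS wS; split.
    exact: (dual_set_mono VK SV TS wS).
  apply: (dual_set_not_interior hK haff hgamma0 VK SV _ T0 wS).
  by rewrite fproperEcard TS Scard hT.1 ltnSn.
Qed.
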